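(* Let $\mathcal X=\{x\in\mathbb R^n:\|x\|_2\le1\}$ and $\mathcal Z=\{z\in\mathbb R^n:\|z\|_2\le1\}$. Let $N\ge3$ and let the reference distribution be $\hat{\mathbb P}_N=\frac1N\sum_{i=1}^N\delta_{\hat z_i}$, where $\hat z_1=0$ and $\hat z_2,\dots,\hat z_N$ are distinct points with $\|\hat z_i\|_2=1$ and $\sum_{i=2}^N\hat z_i=0$. Set $\rho=1/(2N)$ and $c(z,\hat z)=\|z-\hat z\|_2$. Let $v_1,\dots,v_{n+1}\in\mathbb R^n$ be the vertices of a regular $n$-simplex centered at the origin with $\|v_k\|_2=1$ for $1\le k\le n+1$. Assume the boundary samples $\{\hat z_i\}_{i=2}^N$ and the vertices $\{v_k\}_{k=1}^{n+1}$ are disjoint, that is, $M:=\max_{2\le i\le N,\,1\le k\le n+1}\hat z_i^\top v_k<1$. Choose constants $\gamma,\epsilon$ with $M<\gamma<1$ and $0<\epsilon<\min\{1-\gamma,\gamma-M\}$. Define $$\ell_k(x,z)=\|x\|_2^2-2x^\top z+v_k^\top z-\epsilon,\quad k=1,\dots,n+1,$$ $$\ell_{n+1+k}(x,z)=\|x\|_2^2-2x^\top z+\gamma\hat z_k^\top z,\quad k=1,\dots,N,$$ and $\ell(x,z)=\max_{1\le k\le N+n+1}\ell_k(x,z)$. Then any least-favorable distribution, i.e. any maximizer of the dual DRO problem $$\max_{\mathbb Q\in\mathcal P}\min_{x\in\mathcal X}\mathbb E_{z\sim\mathbb Q}[\ell(x,z)],$$ requires a support of at least $N+n+1$ distinct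 atoms. Moreover, the unique optimal least-favorable distribution attaining this minimum support is $$\mathbb Q^\star_{\mathrm{dual}}=\frac1N\Big[\frac12\delta_0+\frac1{2(n+1)}\sum_{k=1}^{n+1}\delta_{v_k}\Big]+\frac1N\sum_{i=2}^N\delta_{\hat z_i}.$$
   Context: $\mathcal P$ is the set of Borel probability measures $\mathbb Q$ on $\mathcal Z$ with $\mathrm{OT}_c(\mathbb Q,\hat{\mathbb P}_N)\le\rho$, where $\mathrm{OT}_c(\mathbb P,\mathbb Q)=\min_\gamma\mathbb E_{(z,\hat z)\sim\gamma}[c(z,\hat z)]$ is the minimum over all couplings $\gamma$ of $\mathbb P$ and $\mathbb Q$. *)

(* Defs.v *)
From mathcomp Require Import all_boot all_order all_algebra.
From mathcomp Require Import all_classical all_reals all_analysis.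

Set Implicit Arguments.
Unset Strict Implicit.
Unset Printing Implicit Defensive.

Import Order.TTheory GRing.Theory Num.Theory.
Import numFieldNormedType.Exports.

Local Open Scope classical_set_scope.
Local Open Scope ring_scope.

Definition is_maximum (R : realType) (S : set R) (m : R) : Prop :=
  S m /\ ubound S m.

Section Euclidean.
Context {R : realType} {n : nat}.

Definition dotv (x y : 'rV[R]_n) : R := \sum_(i < n) x 0 i * y 0 i.

(* The library norm `|x| on 'rV[R]_n is the sup norm, hence this definition.
   Both norms induce the same topology. *)
Definition norm2 (x : 'rV[R]_n) : R := Num.sqrt (dotv x x).

Definition unit_ball2 : set 'rV[R]_n := [set x | norm2 x <= 1].

Definition affinely_independent (m : nat) (v : 'I_m -> 'rV[R]_n) : Prop :=
  forall a : 'I_m -> R,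
    \sum_(k < m) a k = 0 -> \sum_(k < m) a k *: v k = 0 -> forall k, a k = 0.

Definition regular_simplex (v : 'I_n.+1 -> 'rV[R]_n) : Prop :=
  affinely_independent v /\
  exists d : R, forall j k, j != k -> norm2 (v j - v k) = d.

End Euclidean.

(* R^n with its Borel sigma-algebra. *)
Definition borelRV (R : realType) (n : nat) :=
  g_sigma_algebraType (@open 'rV[R]_n).

Section OptimalTransport.
Context {R : realType} {n : nat}.
Local Open Scope ereal_scope.

Definition coupling (mu nu : set (borelRV R n) -> \bar R)
    (pi : probability (borelRV R n * borelRV R n)%type R) : Prop :=
  forall A : set (borelRV R n), measurable A ->
    pi (A `*` setT) = mu A /\ pi (setT `*` A) = nu A.

(* For the continuous nonnegative costs considered here the infimum over
   couplings is a minimum. *)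
Definition OT (c : 'rV[R]_n -> 'rV[R]_n -> R)
    (mu nu : set (borelRV R n) -> \bar R) : \bar R :=
  ereal_inf [set 'E_pi[fun z => c z.1 z.2] | pi in coupling mu nu].

(* Borel probability measures on a Borel set Z are represented by the Borel
   probability measures Q on R^n with Q Z = 1. *)
Definition ambiguity_set (Z : set 'rV[R]_n) (c : 'rV[R]_n -> 'rV[R]_n -> R)
    (nu : set (borelRV R n) -> \bar R) (rho : R) :
    set (probability (borelRV R n) R) :=
  [set Q | Q Z = 1 /\ OT c Q nu <= rho%:E].

(* With X compact and x |-> 'E_Q[l x] continuous the infimum is a minimum. *)
Definition dual_value (X : set 'rV[R]_n) (l : 'rV[R]_n -> 'rV[R]_n -> R)
    (Q : probability (borelRV R n) R) : \bar R :=
  ereal_inf [set 'E_Q[l x] | x in X].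

Definition least_favorable (X : set 'rV[R]_n)
    (l : 'rV[R]_n -> 'rV[R]_n -> R)
    (P : set (probability (borelRV R n) R))
    (Q : probability (borelRV R n) R) : Prop :=
  P Q /\ forall Q', P Q' -> dual_value X l Q' <= dual_value X l Q.

Definition msupport (Q : probability (borelRV R n) R) : set 'rV[R]_n :=
  [set z | forall U : set 'rV[R]_n, open U -> U z -> 0 < Q U].

Definition atoms (Q : probability (borelRV R n) R) : set 'rV[R]_n :=
  [set z | 0 < Q [set z]].

Definition empirical (N : nat) (zhat : 'I_N -> 'rV[R]_n)
    (A : set (borelRV R n)) : \bar R :=
  (N%:R^-1)%:E * \sum_(i < N) \d_(zhat i : borelRV R n) A.

(* Samples are 0-based: the mathematical \hat z_1 is the sample with index 0. *)
Definition Qdual (N : nat) (zhat : 'I_N -> 'rV[R]_n)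
    (v : 'I_n.+1 -> 'rV[R]_n) (A : set (borelRV R n)) : \bar R :=
  (N%:R^-1)%:E *
    ((2^-1)%:E * \d_(0%R : borelRV R n) A +
     ((2 * n.+1%:R)^-1)%:E * \sum_(k < n.+1) \d_(v k : borelRV R n) A) +
  (N%:R^-1)%:E * \sum_(i < N | (0 < i)%N) \d_(zhat i : borelRV R n) A.

End OptimalTransport.

Section Loss.
Context {R : realType} {n N : nat}.
Variables (zhat : 'I_N -> 'rV[R]_n) (v : 'I_n.+1 -> 'rV[R]_n) (gamma eps : R).

(* The first n.+1 indices are the vertex pieces, the last N the sample pieces. *)
Definition loss_piece (k : 'I_(n.+1 + N)) (x z : 'rV[R]_n) : R :=
  match fintype.split k with
  | inl j => norm2 x ^+ 2 - 2 * dotv x z + dotv (v j) z - eps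
  | inr i => norm2 x ^+ 2 - 2 * dotv x z + gamma * dotv (zhat i) z
  end.

(* The default value of the iterated maximum is one of the pieces, so this is
   the maximum of the pieces. *)
Definition loss (x z : 'rV[R]_n) : R :=
  \big[Num.max/loss_piece (lshift N ord0) x z]_(k < n.+1 + N) loss_piece k x z.

End Loss.

(* Main.v *)
From HB Require Import structures.
Require Import Defs.
From mathcomp Require Import all_boot all_order all_algebra.
From mathcomp Require Import all_classical all_reals all_analysis.
From mathcomp Require Import measurable_realfun ring lra.

(** With g = loss 0, completing the square gives, for Q of mean m,
    min_x E_Q[loss x] = E_Q[g] - |m|^2. Linear-programming duality with
    multiplier 1 - eps for the transport budget bounds E_Q[g]: the slack
    (1 - eps) |z - y| + g y - g z is nonnegative for z in the ball and y a
    sample, and vanishes only for z = y, or for y = 0 and z a vertex v_k.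
    Qdual attains the bound and has mean 0. Conversely, a maximizer admits
    plans of arbitrarily small expected slack, so it is carried by the finite
    set of samples and vertices, has mass 1/N at every nonzero sample, and has
    mean 0. Affine independence of the v_k makes their masses equal, and the
    value of E_Q[g] fixes their sum. Hence Qdual is the only maximizer,
    whatever the size of the support. *)

Import Order.TTheory GRing.Theory Num.Theory.
Import numFieldNormedType.Exports.

Local Open Scope classical_set_scope.
Local Open Scope card_scope.
Local Open Scope ring_scope.

Set Implicit Arguments.
Unset Strict Implicit.
Unset Printing Implicit Defensive.

(** * Borel sets and functions on R^n *)

Lemma measurable_coord (R : realType) (n : nat) (i : 'I_n) :
  measurable_fun setT (fun z : borelRV R n => (z : 'rV[R]_n) 0 i).
Proof.
apply: (measurability _ (RGenOpens.measurableE R)).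
move=> _ [_ [a [b ->] <-]]; rewrite setTI; apply: sub_sigma_algebra.
have /continuousP cz : continuous (fun z : 'rV[R]_n => z 0 i).
  exact: coord_continuous.
exact/cz/interval_open.
Qed.

Lemma measurable_dotv (R : realType) (n : nat) d (T : measurableType d)
    (f g : T -> borelRV R n) :
  measurable_fun setT f -> measurable_fun setT g ->
  measurable_fun setT (fun t => dotv (f t : 'rV[R]_n) (g t)).
Proof.
move=> mf mg; apply: measurable_sum => i; apply: measurable_funM.
  exact: (measurableT_comp (@measurable_coord R n i) mf).
exact: (measurableT_comp (@measurable_coord R n i) mg).
Qed.

Lemma measurable_sqrt (R : realType) : measurable_fun setT (@Num.sqrt R).
Proof. by apply: continuous_measurable_fun; exact: sqrt_continuous. Qed.

Lemma measurable_dist2 (R : realType) (n : nat) d (T : measurableType d)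
    (f g : T -> borelRV R n) :
  measurable_fun setT f -> measurable_fun setT g ->
  measurable_fun setT (fun t => norm2 ((f t : 'rV[R]_n) - (g t : 'rV[R]_n))).
Proof.
move=> mf mg; apply: (measurableT_comp (@measurable_sqrt R)).
have mB i : measurable_fun setT
    (fun t => ((f t : 'rV[R]_n) - (g t : 'rV[R]_n)) 0 i).
  under eq_fun do rewrite !mxE.
  apply: measurable_funB.
    exact: (measurableT_comp (@measurable_coord R n i) mf).
  exact: (measurableT_comp (@measurable_coord R n i) mg).
by apply: measurable_sum => i; exact: measurable_funM.
Qed.

Lemma measurable_open_rV (R : realType) (n : nat) (U : set 'rV[R]_n) :
  open U -> measurable (U : set (borelRV R n)).
Proof. by move=> oU; exact: sub_sigma_algebra. Qed.

Lemma measurable_closed_rV (R : realType) (n : nat) (U : set 'rV[R]_n) :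
  closed U -> measurable (U : set (borelRV R n)).
Proof.
by move=> cU; rewrite -[X in measurable X]setCK; apply: measurableC;
  apply: measurable_open_rV; exact: closed_openC.
Qed.

Lemma closed_rV1 (R : realType) (n : nat) (x : 'rV[R]_n) : closed [set x].
Proof.
apply: accessible_closed_set1; apply: hausdorff_accessible.
exact: norm_hausdorff.
Qed.

(** * Finitely supported measures *)

Section Discrete.
Context d (T : measurableType d) (R : realType) (K : nat).
Variables (w : 'I_K -> R) (p : 'I_K -> T).

Definition weighted_diracs (A : set T) : \bar R :=
  (\sum_(k < K) (w k)%:E * \d_(p k) A)%E.

Hypothesis w_ge0 : forall k, 0 <= w k.

Definition weighted_dirac (k : nat) : measure T R :=
  if insub k is Some i then mscale (NngNum (w_ge0 i)) \d_(p i) else mzero.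

Lemma msum_weighted_diracs (A : set T) :
  msum weighted_dirac K A = weighted_diracs A.
Proof.
by apply: eq_bigr => k _; rewrite /weighted_dirac insubT/= => [|?];
  rewrite ?ltn_ord// /mscale/=; congr (_%:E * \d_(p _) _)%E;
  [congr (w _)|]; apply: val_inj.
Qed.

Lemma weighted_diracs_integral (mu : measure T R) (f : T -> R) :
  (forall A, measurable A -> mu A = weighted_diracs A) ->
  measurable_fun setT f ->
  (\int[mu]_x (f x)%:E = (\sum_(k < K) w k * f (p k))%:E)%E.
Proof.
move=> muE mf.
have ge0E (g : T -> \bar R) : measurable_fun setT g ->
    (forall x, 0 <= g x)%E ->
    (\int[mu]_x g x = \sum_(k < K) (w k)%:E * g (p k))%E.
  move=> mg g0.
  rewrite (eq_measure_integral (msum weighted_dirac K)); last first.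
    by move=> A mA _; rewrite muE// -msum_weighted_diracs.
  rewrite ge0_integral_measure_sum//; apply: eq_bigr => k _.
  rewrite /weighted_dirac insubT// => ?; rewrite ge0_integral_mscale//.
  rewrite integral_dirac// diracT mul1e/=.
  congr (_%:E * g (p _))%E; [congr (w _)|]; exact: val_inj.
have mf' : measurable_fun setT (EFin \o f) by exact/measurable_EFinP.
rewrite integralE !ge0E//.
- under eq_bigr do rewrite funeposE -EFin_max -EFinM.
  under [X in (_ - X)%E]eq_bigr do rewrite funenegE -EFinN -EFin_max -EFinM.
  rewrite !sumEFin -EFinB -sumrB; congr EFin; apply: eq_bigr => k _.
  by rewrite -mulrBr; congr (_ * _); exact: (congr1 (@^~ _) (funrposBneg f)).
- exact: measurable_funeneg.
- exact: measurable_funepos.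
Qed.

Lemma weighted_diracs_probability : \sum_(k < K) w k = 1 ->
  exists P : probability T R, forall A, P A = weighted_diracs A.
Proof.
move=> w1.
have P1 : msum weighted_dirac K setT = 1%E.
  rewrite msum_weighted_diracs /weighted_diracs.
  by under eq_bigr do rewrite diracT mule1; rewrite sumEFin w1.
pose P := msum weighted_dirac K.
pose H := Measure_isProbability.Build _ _ _ P P1.
pose Q : probability T R := HB.pack P H.
by exists Q => A; exact: msum_weighted_diracs.
Qed.
End Discrete.

Lemma exists_lower_bound (R : realType) (I : finType) (P : pred I) (F : I -> R) :
  (forall i, P i -> 0 < F i) ->
  exists2 eta, 0 < eta & forall i, P i -> eta <= F i.
Proof.
move=> F0; exists (\big[Num.min/1]_(i | P i) F i).
  exact: lt_bigmin.
by move=> i Pi; exact: bigmin_le_cond.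
Qed.

Section EuclideanTheory.
Context {R : realType} {n : nat}.
Implicit Types x y z : 'rV[R]_n.

Lemma dotvC x y : dotv x y = dotv y x.
Proof. by apply: eq_bigr => i _; rewrite mulrC. Qed.

Lemma dotvDl x y z : dotv (x + y) z = dotv x z + dotv y z.
Proof. by rewrite -big_split; apply: eq_bigr => i _; rewrite mxE mulrDl. Qed.

Lemma dotvZl a x y : dotv (a *: x) y = a * dotv x y.
Proof. by rewrite mulr_sumr; apply: eq_bigr => i _; rewrite mxE mulrA. Qed.

Lemma dotv0l y : dotv 0 y = 0.
Proof. by rewrite -[0](scale0r 0) dotvZl mul0r. Qed.

Lemma dotvNl x y : dotv (- x) y = - dotv x y.
Proof. by rewrite -scaleN1r dotvZl mulN1r. Qed.

Lemma dotv_suml (I : finType) (P : pred I) (f : I -> 'rV[R]_n) y :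
  dotv (\sum_(i | P i) f i) y = \sum_(i | P i) dotv (f i) y.
Proof.
elim/big_rec2: _ => [|i u w _ <-]; first exact: dotv0l.
by rewrite dotvDl.
Qed.

Lemma dotvv_ge0 x : 0 <= dotv x x.
Proof. by apply: sumr_ge0 => i _; rewrite -expr2 sqr_ge0. Qed.

Lemma dotvv_eq0 x : dotv x x <= 0 -> x = 0.
Proof.
move=> x0; have {}x0 : dotv x x = 0 by apply/eqP; rewrite eq_le x0 dotvv_ge0.
apply/rowP => i; rewrite mxE; apply/eqP; rewrite -sqrf_eq0 expr2.
apply/eqP; apply: (psumr_eq0P _ x0) => // j _.
by rewrite -expr2 sqr_ge0.
Qed.

Lemma norm2_ge0 x : 0 <= norm2 x. Proof. exact: sqrtr_ge0. Qed.

Lemma norm2_sqr x : norm2 x ^+ 2 = dotv x x.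
Proof. by rewrite sqr_sqrtr// dotvv_ge0. Qed.

Lemma norm2_0 : norm2 (0 : 'rV[R]_n) = 0.
Proof. by rewrite /norm2 dotv0l sqrtr0. Qed.

Lemma norm2_gt0 x : x != 0 -> 0 < norm2 x.
Proof.
move=> x0; rewrite lt_def norm2_ge0 andbT; apply: contra x0 => /eqP nx.
by apply/eqP; apply: dotvv_eq0; rewrite -norm2_sqr nx expr0n.
Qed.

Lemma dotv_subsub x y :
  dotv (x - y) (x - y) = dotv x x - 2 * dotv x y + dotv y y.
Proof.
rewrite dotvDl dotvNl !(dotvC _ (x - y)) !dotvDl !dotvNl (dotvC y x).
by ring.
Qed.

Lemma dotv_le_norm2 x y : dotv x y <= norm2 x * norm2 y.
Proof.
have [->|x0] := eqVneq x 0; first by rewrite dotv0l norm2_0 mul0r.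
have [->|y0] := eqVneq y 0; first by rewrite dotvC dotv0l norm2_0 mulr0.
have a0 := norm2_gt0 x0; have b0 := norm2_gt0 y0.
have := dotvv_ge0 (norm2 y *: x - norm2 x *: y).
rewrite dotv_subsub !dotvZl !(dotvC _ (_ *: _)) !dotvZl -!norm2_sqr dotvC.
set a := norm2 x in a0 *; set b := norm2 y in b0 *; set c := dotv x y => h.
have ab : 0 < a * b by rewrite mulr_gt0.
rewrite -subr_ge0 -(pmulr_rge0 _ ab); nra.
Qed.

Lemma norm2_sub_le2 x y : norm2 x <= 1 -> norm2 y <= 1 -> norm2 (x - y) <= 2.
Proof.
move=> x1 y1; rewrite -(@ler_pXn2r _ 2)// ?nnegrE ?norm2_ge0//.
have := dotv_le_norm2 (- x) y; rewrite dotvNl.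
have -> : norm2 (- x) = norm2 x by rewrite /norm2 dotvNl dotvC dotvNl opprK.
rewrite norm2_sqr dotv_subsub -!norm2_sqr.
have := norm2_ge0 x; have := norm2_ge0 y.
set a := norm2 x in x1 *; set b := norm2 y in y1 *; set c := dotv x y.
move=> a0 b0 h; nra.
Qed.

Lemma dotv_lt1 x y : norm2 x <= 1 -> norm2 y <= 1 -> x != y -> dotv x y < 1.
Proof.
move=> x1 y1; apply: contra_neqT; rewrite -leNgt => h; apply/subr0_eq/dotvv_eq0.
rewrite dotv_subsub -!norm2_sqr.
have := norm2_ge0 x; have := norm2_ge0 y; nra.
Qed.
End EuclideanTheory.

Lemma measurable_bigmaxr d (T : measurableType d) (R : realType) (I : Type)
    (s : seq I) (f0 : T -> R) (f : I -> T -> R) :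
  measurable_fun setT f0 -> (forall i, measurable_fun setT (f i)) ->
  measurable_fun setT (fun t => \big[Num.max/f0 t]_(i <- s) f i t).
Proof.
move=> m0 mf; elim: s => [|i s IH].
  by under eq_fun do rewrite big_nil.
by under eq_fun do rewrite big_cons; exact: measurable_maxr.
Qed.

Lemma measurable_bigminr d (T : measurableType d) (R : realType) (I : Type)
    (s : seq I) (f0 : T -> R) (f : I -> T -> R) :
  measurable_fun setT f0 -> (forall i, measurable_fun setT (f i)) ->
  measurable_fun setT (fun t => \big[Num.min/f0 t]_(i <- s) f i t).
Proof.
move=> m0 mf; elim: s => [|i s IH].
  by under eq_fun do rewrite big_nil.
by under eq_fun do rewrite big_cons; exact: measurable_minr.
Qed.

(** * The loss *)

Section LossTheory.
Context {R : realType} {n N : nat}.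
Variables (zhat : 'I_N -> 'rV[R]_n) (v : 'I_n.+1 -> 'rV[R]_n) (gamma eps : R).
Local Notation piece := (loss_piece zhat v gamma eps).
Local Notation loss := (loss zhat v gamma eps).

Lemma loss_le x z b : (forall k, piece k x z <= b) -> loss x z <= b.
Proof. by move=> h; apply: bigmax_le. Qed.

Lemma loss_lt x z b : (forall k, piece k x z < b) -> loss x z < b.
Proof. by move=> h; apply: bigmax_lt. Qed.

Lemma piece_le_loss x z k : piece k x z <= loss x z.
Proof. exact: le_bigmax. Qed.

Lemma piece_shift x z k :
  piece k x z = norm2 x ^+ 2 - 2 * dotv x z + piece k 0 z.
Proof.
rewrite /loss_piece dotv0l norm2_0.
by case: fintype.split => j; ring.
Qed.

Lemma loss_shift x z : loss x z = norm2 x ^+ 2 - 2 * dotv x z + loss 0 z.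
Proof.
apply/eqP; rewrite eq_le; apply/andP; split.
  by apply: loss_le => k; rewrite piece_shift lerD2l piece_le_loss.
rewrite addrC -lerBrDr; apply: loss_le => k.
by rewrite lerBrDr addrC -piece_shift piece_le_loss.
Qed.

Lemma vertex_le_loss0 z k : dotv (v k) z - eps <= loss 0 z.
Proof.
have := piece_le_loss 0 z (lshift N k).
rewrite /loss_piece (unsplitK (inl k)) norm2_0 dotv0l; lra.
Qed.

Lemma sample_le_loss0 z i : gamma * dotv (zhat i) z <= loss 0 z.
Proof.
have := piece_le_loss 0 z (rshift n.+1 i).
rewrite /loss_piece (unsplitK (inr i)) norm2_0 dotv0l; lra.
Qed.

Lemma loss0_le z b : (forall k, dotv (v k) z - eps <= b) ->
  (forall i, gamma * dotv (zhat i) z <= b) -> loss 0 z <= b.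
Proof.
move=> h1 h2; apply: loss_le => k; rewrite /loss_piece norm2_0 dotv0l.
by case: fintype.split => j; [have := h1 j|have := h2 j]; lra.
Qed.

Lemma loss0_lt z b : (forall k, dotv (v k) z - eps < b) ->
  (forall i, gamma * dotv (zhat i) z < b) -> loss 0 z < b.
Proof.
move=> h1 h2; apply: loss_lt => k; rewrite /loss_piece norm2_0 dotv0l.
by case: fintype.split => j; [have := h1 j|have := h2 j]; lra.
Qed.

Let measurable_piece x k :
  measurable_fun setT (fun z : borelRV R n => piece k x (z : 'rV[R]_n)).
Proof.
have mdot u : measurable_fun setT (fun z : borelRV R n => dotv u (z : 'rV[R]_n)).
  exact: (measurable_dotv (f := cst (u : borelRV R n))).
have mb a b u : measurable_fun setT
    (fun z : borelRV R n => a - b * dotv u (z : 'rV[R]_n)).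
  by apply: measurable_funB => //; exact: measurable_funM.
rewrite /loss_piece; case: fintype.split => j.
  by apply: measurable_funB => //; apply: measurable_funD (mdot _).
by apply: measurable_funD => //; exact: measurable_funM.
Qed.

Lemma measurable_loss x :
  measurable_fun setT (fun z : borelRV R n => loss x (z : 'rV[R]_n)).
Proof.
apply: measurable_bigmaxr => [|k]; exact: measurable_piece.
Qed.
End LossTheory.

(** * Couplings with an empirical measure *)

Section Coupling.
Context (R : realType) (n : nat).
Local Notation T := (borelRV R n).
Implicit Types (Q : probability T R) (pi : probability (T * T)%type R).

Lemma coupling_integral_fst Q nu pi (f : T -> R) :
  coupling Q nu pi -> measurable_fun setT f -> (forall z, 0 <= f z) ->
  (\int[pi]_z (f z.1)%:E = \int[Q]_z (f z)%:E)%E.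
Proof.
move=> piQ mf f0.
rewrite -(@eq_measure_integral _ _ _ setT Q (pushforward pi fst)) => [|A mA _].
  rewrite ge0_integral_pushforward//; first exact/measurable_EFinP.
  by move=> z _; rewrite lee_fin.
apply: etrans (piQ A mA).1; congr (pi _).
by apply/seteqP; split=> z //= [].
Qed.

Lemma empirical_weighted_diracs N (zhat : 'I_N -> 'rV[R]_n) (A : set T) :
  empirical zhat A = weighted_diracs (fun=> N%:R^-1) (zhat : 'I_N -> T) A.
Proof. by rewrite /empirical ge0_sume_distrr. Qed.

Lemma coupling_integral_snd N (zhat : 'I_N -> 'rV[R]_n) mu pi (f : T -> R) :
  coupling mu (empirical zhat) pi -> measurable_fun setT f ->
  (forall z, 0 <= f z) ->
  (\int[pi]_z (f z.2)%:E = (\sum_(i < N) N%:R^-1 * f (zhat i))%:E)%E.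
Proof.
move=> piP mf f0.
have w0 (k : 'I_N) : 0 <= N%:R^-1 :> R by rewrite invr_ge0.
rewrite -(weighted_diracs_integral (p := (zhat : 'I_N -> T)) w0
  (mu := pushforward pi snd) (f := f)).
- rewrite ge0_integral_pushforward//; first exact/measurable_EFinP.
  by move=> z _; rewrite lee_fin.
- move=> A mA; rewrite -empirical_weighted_diracs -(piP A mA).2.
  by congr (pi _); apply/seteqP; split=> z //= [].
- exact: mf.
Qed.

Lemma closed_range_ord N (p : 'I_N -> 'rV[R]_n) : closed (range p).
Proof.
have -> : range p = \bigcup_(i in [set: 'I_N]) [set p i].
  by apply/seteqP; split=> [_ [i _ <-]|_ [i _ ->]]; exists i.
apply: closed_bigcup => [|i _]; [exact: finite_finset|].
exact: closed_rV1.
Qed.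

Lemma measurable_rV1 (x : 'rV[R]_n) : measurable ([set x] : set T).
Proof. by apply: measurable_closed_rV; exact: closed_rV1. Qed.

Lemma finite_support_weighted_diracs K (p : 'I_K -> 'rV[R]_n) Q (A : set T) :
  injective p -> Q (~` range p) = 0%E -> measurable A ->
  Q A = weighted_diracs (fun k => fine (Q [set p k])) (p : 'I_K -> T) A.
Proof.
move=> pI Q0 mA.
have mp : measurable (range p : set T).
  by apply: measurable_closed_rV; exact: closed_range_ord.
rewrite -[in LHS](setUIDK A (range p)) measureU; last 3 first.
- exact: measurableI.
- exact: measurableD.
- by rewrite setIDA setIAC -setIDA setDv setI0.
rewrite [X in (_ + X)%E](_ : _ = 0%E) ?adde0; last first.
  apply: (subset_measure0 _ _ _ Q0); [|exact: measurableC|by move=> z []].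
  exact: measurableD.
rewrite (_ : _ `&` _ = \big[setU/set0]_(k in [pred k | p k \in A]) [set p k]);
    last first.
  rewrite -bigcup_pred; apply/seteqP; split=> [z [Az [k _ pk]]|z [k]].
    by exists k; rewrite /= ?inE/= ?pk// inE.
  by rewrite /= unfold_in => /set_mem Ak ->; split=> //; exists k.
rewrite measure_bigsetU_ord => [|k|]; last 2 first.
- exact: measurable_rV1.
- by apply/trivIsetP => i j _ _ ij; apply/seteqP; split=> // z [/= -> /pI /eqP];
    rewrite (negPf ij).
rewrite big_mkcond; apply: eq_bigr => k _; rewrite inE diracE.
have [Ak|Ak] := pselect (A (p k)); last by rewrite !memNset// mule0.
by rewrite !mem_set// mule1 fineK ?fin_num_measure//; exact: measurable_rV1.
Qed.

Lemma measurable_unit_ball2 : measurable (unit_ball2 : set T).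
Proof.
have mn : measurable_fun setT (fun z : T => norm2 ((z : 'rV[R]_n) - 0)).
  by apply: (measurable_dist2 (f := id) (g := cst (0 : T))).
rewrite (_ : unit_ball2 = (fun z : T => norm2 ((z : 'rV[R]_n) - 0)) @^-1` `]-oo, 1]).
  by rewrite -[X in measurable X]setTI; exact: mn.
by apply/seteqP; split=> z /=; rewrite in_itv/= subr0.
Qed.

Lemma coupling_ae N (zhat : 'I_N -> 'rV[R]_n) Q pi :
  Q unit_ball2 = 1%E -> coupling Q (empirical zhat) pi ->
  {ae pi, forall z, unit_ball2 (z.1 : 'rV[R]_n) /\ range zhat (z.2 : 'rV[R]_n)}.
Proof.
move=> Q1 piQ.
have mB : measurable (~` (unit_ball2 : set T)).
  by apply: measurableC; exact: measurable_unit_ball2.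
have mF : measurable (~` (range zhat : set T)).
  by apply: measurableC; apply: measurable_closed_rV; exact: closed_range_ord.
have aeB : {ae pi, forall z, unit_ball2 (z.1 : 'rV[R]_n)}.
  exists ((~` unit_ball2) `*` setT); split; first exact: measurableX.
    apply: etrans (piQ _ mB).1 _.
    rewrite probability_setC; last exact: measurable_unit_ball2.
    by rewrite Q1 subee.
  by move=> z /= zB; split.
have aeF : {ae pi, forall z, range zhat (z.2 : 'rV[R]_n)}.
  exists (setT `*` (~` range zhat)); split; first exact: measurableX.
    apply: etrans (piQ _ mF).2 _.
    rewrite /empirical big1 ?mule0// => i _.
    by rewrite diracE memNset//=; apply; exists i.
  by move=> z /= zB; split.
have aeFilter := ae_filter_ringOfSetsType pi.
by apply: filterS2 aeB aeF => z; split.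
Qed.
End Coupling.

(** * The duality bound *)

Section Setting.
Context (R : realType) (n N : nat)
    (zhat : 'I_N -> 'rV[R]_n) (v : 'I_n.+1 -> 'rV[R]_n) (M gamma eps : R)
    (N_ge3 : (3 <= N)%N)
    (zhat_first : forall i : 'I_N, i = 0%N :> nat -> zhat i = 0)
    (zhat_distinct : forall i j : 'I_N, (0 < i)%N -> (0 < j)%N ->
       zhat i = zhat j -> i = j)
    (zhat_norm : forall i : 'I_N, (0 < i)%N -> norm2 (zhat i) = 1)
    (zhat_sum : \sum_(i < N | (0 < i)%N) zhat i = 0)
    (v_simplex : regular_simplex v)
    (v_centered : \sum_(k < n.+1) v k = 0)
    (v_norm : forall k : 'I_n.+1, norm2 (v k) = 1)
    (M_max : is_maximum
       [set dotv (zhat i) (v k) | i in [set i : 'I_N | (0 < i)%N]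
                                & k in [set: 'I_n.+1]] M)
    (M_lt1 : M < 1)
    (gamma_gtM : M < gamma) (gamma_lt1 : gamma < 1)
    (eps_gt0 : 0 < eps) (eps_lt : eps < Num.min (1 - gamma) (gamma - M)).

Local Notation g := (loss zhat v gamma eps 0).

Let i0 : 'I_N := Ordinal (ltn_trans (isT : (0 < 2)%N) N_ge3).
Let i1 : 'I_N := Ordinal (ltn_trans (isT : (1 < 2)%N) N_ge3).

Let zhat0 : zhat i0 = 0. Proof. exact: zhat_first. Qed.

Lemma eps_lt_subgamma : eps < 1 - gamma.
Proof. by move: eps_lt; rewrite lt_min => /andP[]. Qed.

Lemma eps_lt_subM : eps < gamma - M.
Proof. by move: eps_lt; rewrite lt_min => /andP[]. Qed.

Lemma dotv_zhat_v (i : 'I_N) k : (0 < i)%N -> dotv (zhat i) (v k) <= M.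
Proof. by move=> i0'; apply: (M_max.2); exists i => //; exists k. Qed.

Lemma M_ge0 : 0 <= M.
Proof.
have : 0 <= \sum_(i < N | (0 < i)%N) (M - dotv (zhat i) (v ord0)).
  by apply: sumr_ge0 => i i_gt0; rewrite subr_ge0 dotv_zhat_v.
rewrite sumrB -dotv_suml zhat_sum dotv0l subr0 sumr_const pmulrn_lge0//.
by apply/card_gt0P; exists i1.
Qed.

Let gamma_gt0 : 0 < gamma. Proof. exact: le_lt_trans M_ge0 gamma_gtM. Qed.

Lemma zhat_le1 i : norm2 (zhat i) <= 1.
Proof.
have [|i_gt0] := posnP i; last by rewrite zhat_norm.
by move/zhat_first ->; rewrite norm2_0.
Qed.

Lemma loss0_ge0 z : 0 <= g z.
Proof.
by have := sample_le_loss0 zhat v gamma eps z i0; rewrite zhat0 dotv0l mulr0.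
Qed.

Lemma loss0_0 : g 0 = 0.
Proof.
have e0 := eps_gt0; apply/eqP; rewrite eq_le loss0_ge0 andbT; apply: loss0_le => k.
  by rewrite dotvC dotv0l; lra.
by rewrite dotvC dotv0l mulr0.
Qed.

Lemma loss0_zhat (i : 'I_N) : (0 < i)%N -> g (zhat i) = gamma.
Proof.
move=> i_gt0.
have e0 := eps_gt0; have c0 := gamma_gt0.
have e2 := eps_lt_subM; apply/eqP; rewrite eq_le; apply/andP; split.
  apply: loss0_le => j.
    by rewrite dotvC; have := dotv_zhat_v j i_gt0; lra.
  have := dotv_le_norm2 (zhat j) (zhat i); rewrite (zhat_norm i_gt0) mulr1.
  by have := zhat_le1 j; nra.
have := sample_le_loss0 zhat v gamma eps (zhat i) i.
by rewrite -norm2_sqr zhat_norm// expr1n mulr1.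
Qed.

Lemma loss0_vertex k : g (v k) = 1 - eps.
Proof.
have e1 := eps_lt_subgamma.
have e0 := eps_gt0; have c0 := gamma_gt0.
apply/eqP; rewrite eq_le; apply/andP; split.
  apply: loss0_le => j.
    by have := dotv_le_norm2 (v j) (v k); rewrite !v_norm; lra.
  have := dotv_le_norm2 (zhat j) (v k); rewrite v_norm mulr1.
  by have := zhat_le1 j; nra.
have := vertex_le_loss0 zhat v gamma eps (v k) k.
by rewrite -norm2_sqr v_norm expr1n.
Qed.

Lemma loss0_lt_center z : norm2 z <= 1 -> z != 0 -> (forall k, z != v k) ->
  g z < (1 - eps) * norm2 z.
Proof.
move=> z1 z0 zv; have nz := norm2_gt0 z0; have e1 := eps_lt_subgamma.
have e0 := eps_gt0; have c0 := gamma_gt0.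
apply: loss0_lt => k; last first.
  have h := ler_piMl (ltW nz) (zhat_le1 k).
  have := le_trans (dotv_le_norm2 _ _) h; nra.
have [z_lt1|z_ge1] := ltP (norm2 z) 1.
  by have := dotv_le_norm2 (v k) z; rewrite v_norm; nra.
have -> : norm2 z = 1 by lra.
by have := @dotv_lt1 _ _ z (v k) z1; rewrite v_norm dotvC => /(_ _ (zv k)); lra.
Qed.

Lemma loss0_lt_sample z (i : 'I_N) : norm2 z <= 1 -> (0 < i)%N -> z != zhat i ->
  g z < (1 - eps) * norm2 (z - zhat i) + gamma.
Proof.
move=> z1 i_gt0 zi; have e1 := eps_lt_subgamma.
have e0 := eps_gt0; have c0 := gamma_gt0; have e2 := eps_lt_subM.
have d0 : 0 < norm2 (z - zhat i) by rewrite norm2_gt0// subr_eq0.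
have d2 := norm2_sub_le2 z1 (zhat_le1 i).
have dotE u : dotv u z = dotv u (zhat i) + dotv u (z - zhat i).
  by rewrite !(dotvC u) -dotvDl addrC subrK.
apply: loss0_lt => k; rewrite dotE.
  have := dotv_le_norm2 (v k) (z - zhat i); rewrite v_norm mul1r.
  by have := dotv_zhat_v k i_gt0; rewrite dotvC; nra.
have := dotv_le_norm2 (zhat k) (z - zhat i).
have := dotv_le_norm2 (zhat k) (zhat i); rewrite (zhat_norm i_gt0) mulr1.
have := zhat_le1 k; have := norm2_ge0 (zhat k).
set a := norm2 (zhat k); set x := dotv _ _; set y := dotv _ _.
set d := norm2 _ in d0 d2 *.
move=> a0 a1 xa ya.
have : x <= 1 by lra. have : y <= d by nra.
nra.
Qed.

Definition slack (z y : 'rV[R]_n) : R := (1 - eps) * norm2 (z - y) + g y - g z.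

Lemma slack_gt0 z (i : 'I_N) : norm2 z <= 1 -> z != zhat i ->
  (i = 0%N :> nat -> forall k, z != v k) -> 0 < slack z (zhat i).
Proof.
move=> z1 zi zv; rewrite subr_gt0; have [i_eq0|i_gt0] := posnP i.
  move: zi; rewrite zhat_first// => zi; rewrite loss0_0 subr0 addr0.
  by rewrite loss0_lt_center// => k; exact: zv.
by rewrite loss0_zhat// loss0_lt_sample.
Qed.

Lemma slack_ge0 z (i : 'I_N) : norm2 z <= 1 -> 0 <= slack z (zhat i).
Proof.
move=> z1; have [->|zi] := eqVneq z (zhat i).
  by rewrite /slack subrr norm2_0 mulr0 add0r subrr.
have [i_eq0|i_gt0] := posnP i; last first.
  by apply/ltW/slack_gt0 => // i_eq0; rewrite i_eq0 in i_gt0.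
have [[k ->]|zv] := pselect (exists k, z = v k).
  by rewrite /slack zhat_first// subr0 v_norm loss0_0 loss0_vertex; lra.
by apply/ltW/slack_gt0 => // _ k; apply: contra_notT zv => /negPn/eqP ->; exists k.
Qed.
Local Notation T := (borelRV R n).
Local Notation rho := ((2 * N%:R)^-1 : R).
Local Notation ball_ambiguity := (ambiguity_set unit_ball2
  (fun z zh : 'rV[R]_n => norm2 (z - zh)) (empirical zhat) rho).
Local Notation dual := (dual_value unit_ball2 (loss zhat v gamma eps)).

Let opt : R := (1 - eps) * rho + \sum_(i < N) N%:R^-1 * g (zhat i).

Definition pslack (z : T * T) : R := Num.max (slack z.1 z.2) 0.

Let measurable_g : measurable_fun setT (fun z : T => g (z : 'rV[R]_n)).
Proof. exact: measurable_loss. Qed.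

Let measurable_slack d (X : measurableType d) (a b : X -> T) :
  measurable_fun setT a -> measurable_fun setT b ->
  measurable_fun setT (fun t => slack (a t : 'rV[R]_n) (b t)).
Proof.
move=> ma mb; apply: measurable_funB; last exact: (measurableT_comp measurable_g ma).
apply: measurable_funD; last exact: (measurableT_comp measurable_g mb).
by apply: measurable_funM => //; exact: measurable_dist2.
Qed.

Let measurable_pslack d (X : measurableType d) (a b : X -> T) :
  measurable_fun setT a -> measurable_fun setT b ->
  measurable_fun setT (fun t => pslack (a t, b t)).
Proof. by move=> ma mb; apply: measurable_maxr => //; exact: measurable_slack. Qed.

Let measurable_pslackT : measurable_fun setT pslack.
Proof.
have := @measurable_pslack _ _ fst snd measurable_fst measurable_snd.
by apply: eq_measurable_fun => -[].
Qed.

Lemma pslack_ge0 z : 0 <= pslack z.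
Proof. by rewrite le_max lexx orbT. Qed.

Lemma pslack_integral_le Q delta : ball_ambiguity Q -> 0 < delta ->
  exists2 pi : probability (T * T)%type R, coupling Q (empirical zhat) pi &
  (\int[Q]_z (g (z : 'rV[R]_n))%:E + \int[pi]_z (pslack z)%:E
    <= (opt + delta)%:E)%E.
Proof.
move=> [Q1 OTQ] d0; have e0 := eps_gt0; have e1 := eps_lt_subgamma; have c0 := gamma_gt0.
have : (ereal_inf [set
    'E_pi[fun z : T * T => norm2 ((z.1 : 'rV[R]_n) - (z.2 : 'rV[R]_n))] |
    pi in coupling Q (empirical zhat)] < (rho + delta)%:E)%E.
  by apply: le_lt_trans OTQ _; rewrite lte_fin ltrDl.
move=> /ereal_inf_lt[_ [pi piQ <-]]; rewrite unlock => cost_lt.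
exists pi => //.
have mc : measurable_fun setT
    (fun z : T * T => norm2 ((z.1 : 'rV[R]_n) - (z.2 : 'rV[R]_n))).
  by apply: measurable_dist2; [exact: measurable_fst|exact: measurable_snd].
have mg1 := measurableT_comp measurable_g (@measurable_fst _ _ T T).
have mg2 := measurableT_comp measurable_g (@measurable_snd _ _ T T).
rewrite -(coupling_integral_fst piQ measurable_g) => [|z]; last exact: loss0_ge0.
rewrite -ge0_integralD//; first last.
- exact/measurable_EFinP.
- by move=> z _; rewrite lee_fin pslack_ge0.
- exact/measurable_EFinP.
- by move=> z _; rewrite lee_fin loss0_ge0.
apply: (@le_trans _ _ (\int[pi]_z ((1 - eps)%:E *
   (norm2 ((z.1 : 'rV[R]_n) - (z.2 : 'rV[R]_n)))%:E + (g (z.2 : 'rV[R]_n))%:E))%E).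
  apply: ae_ge0_le_integral => //.
  - by move=> z _; rewrite adde_ge0 ?lee_fin ?loss0_ge0 ?pslack_ge0.
  - by apply: emeasurable_funD; exact/measurable_EFinP.
  - move=> z _; rewrite -EFinM adde_ge0 ?lee_fin ?loss0_ge0 ?mulr_ge0 ?norm2_ge0//.
    by lra.
  - apply: emeasurable_funD; apply/measurable_EFinP => //.
    exact: measurable_funM.
  - have aeF := ae_filter_ringOfSetsType pi.
    apply: filterS (coupling_ae Q1 piQ) => -[z y] /= [z1 [i _ <-]] _.
    rewrite -EFinM -!EFinD lee_fin /pslack/= max_l ?slack_ge0//.
    by rewrite addrC subrK.
rewrite ge0_integralD//; first last.
- exact/measurable_EFinP.
- by move=> z _; rewrite lee_fin loss0_ge0.
- by apply/measurable_EFinP; exact: measurable_funM.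
- by move=> z _; rewrite -EFinM lee_fin mulr_ge0 ?norm2_ge0//; lra.
rewrite ge0_integralZl//; last 3 first.
- exact/measurable_EFinP.
- by move=> z _; rewrite lee_fin norm2_ge0.
- by rewrite lee_fin; lra.
rewrite (coupling_integral_snd piQ measurable_g) => [|z]; last exact: loss0_ge0.
rewrite /opt -addrA (addrC _ delta) addrA [leRHS]EFinD; apply: leeD2r.
apply: (@le_trans _ _ ((1 - eps)%:E * (rho + delta)%:E)%E).
  by apply: lee_wpmul2l; [rewrite lee_fin; lra|exact: ltW].
by rewrite -EFinM lee_fin; nra.
Qed.

Lemma dual_le_loss Q x : unit_ball2 x ->
  (dual Q <= \int[Q]_z (loss zhat v gamma eps x (z : 'rV[R]_n))%:E)%E.
Proof.
by move=> x1; apply: ereal_inf_lbound; exists x => //; rewrite unlock.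
Qed.

Let unit_ball2_0 : unit_ball2 (0 : 'rV[R]_n).
Proof. by rewrite /unit_ball2/= norm2_0. Qed.

Lemma loss0_integral_le_opt Q : ball_ambiguity Q ->
  (\int[Q]_z (g (z : 'rV[R]_n))%:E <= opt%:E)%E.
Proof.
move=> PQ; apply/lee_addgt0Pr => d d0; have [pi _] := pslack_integral_le PQ d0.
apply: le_trans; rewrite leeDl// integral_ge0// => z _.
by rewrite lee_fin pslack_ge0.
Qed.

Lemma dual_le_opt Q : ball_ambiguity Q -> (dual Q <= opt%:E)%E.
Proof.
by move=> PQ; apply: le_trans (dual_le_loss _ unit_ball2_0) (loss0_integral_le_opt PQ).
Qed.

Definition pt (k : 'I_(N + n.+1)) : 'rV[R]_n :=
  match fintype.split k with inl i => zhat i | inr j => v j end.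

Lemma pt_lshift i : pt (lshift n.+1 i) = zhat i.
Proof. by rewrite /pt (unsplitK (inl i)). Qed.

Lemma pt_rshift j : pt (rshift N j) = v j.
Proof. by rewrite /pt (unsplitK (inr j)). Qed.

Lemma zhat_neq_v (i : 'I_N) j : zhat i != v j.
Proof.
apply/eqP => ij; have [i_eq0|i_gt0] := posnP i.
  by have /eqP := v_norm j; rewrite -ij zhat_first// norm2_0 eq_sym oner_eq0.
have := le_lt_trans (dotv_zhat_v j i_gt0) M_lt1.
by rewrite ij -norm2_sqr v_norm expr1n ltxx.
Qed.

Lemma zhat_inj : injective zhat.
Proof.
have z0 (i j : 'I_N) : i = 0%N :> nat -> zhat i = zhat j -> i = j.
  move=> i_eq0 ij; have [j_eq0|j_gt0] := posnP j.
    by apply: val_inj; rewrite /= i_eq0 j_eq0.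
  have /eqP := zhat_norm j_gt0.
  by rewrite -ij zhat_first// norm2_0 eq_sym oner_eq0.
move=> i j ij; have [i_eq0|i_gt0] := posnP i; first exact: z0.
have [j_eq0|j_gt0] := posnP j; first by apply/esym/z0.
exact: zhat_distinct.
Qed.

Lemma v_inj : injective v.
Proof.
move=> i j ij; apply/eqP; apply/negPn/negP => neq_ij.
pose a k : R := (k == i)%:R - (k == j)%:R.
have sumZ (u : 'I_n.+1) : \sum_k (k == u)%:R *: v k = v u.
  rewrite (bigD1 u)//= eqxx scale1r big1 ?addr0// => k /negPf ->.
  by rewrite scale0r.
have sum1 (u : 'I_n.+1) : \sum_k (k == u)%:R = 1 :> R.
  by rewrite (bigD1 u)//= eqxx big1 ?addr0// => k /negPf ->.
have := v_simplex.1 a; rewrite /a sumrB !sum1 subrr => /(_ erefl).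
under eq_bigr do rewrite scalerBl; rewrite sumrB !sumZ ij subrr.
move=> /(_ erefl i) /eqP; rewrite eqxx (negPf neq_ij) subr0.
by rewrite oner_eq0.
Qed.

Lemma pt_inj : injective pt.
Proof.
move=> k l; rewrite -(splitK k) -(splitK l).
case: (fintype.split k) => i; case: (fintype.split l) => j /=;
  rewrite ?pt_lshift ?pt_rshift.
- by move=> /zhat_inj ->.
- by move=> /eqP; rewrite (negPf (zhat_neq_v _ _)).
- by move=> /esym/eqP; rewrite (negPf (zhat_neq_v _ _)).
- by move=> /v_inj ->.
Qed.

Lemma pt_le1 k : norm2 (pt k) <= 1.
Proof. by rewrite /pt; case: fintype.split => i; [exact: zhat_le1|rewrite v_norm]. Qed.

Lemma range_pt z : ~ range pt z ->
  (forall i, z != zhat i) /\ (forall k, z != v k).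
Proof.
move=> ptz; split=> i; apply: contra_notN ptz => /eqP ->.
  by exists (lshift n.+1 i) => //; rewrite pt_lshift.
by exists (rshift N i) => //; rewrite pt_rshift.
Qed.

Lemma slack_gt0_mismatch (i j : 'I_N) z : (0 < i)%N -> norm2 z <= 1 ->
  (z == zhat i) != (zhat j == zhat i) -> 0 < slack z (zhat j).
Proof.
move=> i_gt0 z1; have [->|zi] := eqVneq z (zhat i).
  rewrite eq_sym; have [//|ij _] := eqVneq (zhat j) (zhat i).
  apply: slack_gt0; [exact: zhat_le1|by rewrite eq_sym|].
  by move=> _ k; exact: zhat_neq_v.
have [/zhat_inj -> _|//] := eqVneq (zhat j) (zhat i); apply: slack_gt0 => // i_eq0.
by rewrite i_eq0 in i_gt0.
Qed.

Let i0E (i : 'I_N) : (i != i0) = (0 < i)%N.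
Proof. by rewrite lt0n. Qed.

Lemma big_pt (V : nmodType) (F : 'I_(N + n.+1) -> V) :
  \sum_k F k = F (lshift _ i0) + \sum_(i < N | (0 < i)%N) F (lshift _ i) +
    \sum_(j < n.+1) F (rshift _ j).
Proof.
rewrite big_split_ord (bigD1 i0)//=.
by under eq_bigl do rewrite i0E.
Qed.

Definition wt (k : 'I_(N + n.+1)) : R :=
  match fintype.split k with
  | inl i => if (0 < i)%N then N%:R^-1 else rho
  | inr _ => rho / n.+1%:R
  end.

Lemma wt_lshift i : wt (lshift _ i) = if (0 < i)%N then N%:R^-1 else rho.
Proof. by rewrite /wt (unsplitK (inl i)). Qed.

Lemma wt_rshift j : wt (rshift N j) = rho / n.+1%:R.
Proof. by rewrite /wt (unsplitK (inr j)). Qed.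

Let N_gt0 : 0 < N%:R :> R. Proof. by rewrite ltr0n (ltn_trans _ N_ge3). Qed.

Let rho_gt0 : 0 < rho. Proof. by rewrite invr_gt0 mulr_gt0. Qed.

Lemma wt_gt0 k : 0 < wt k.
Proof.
rewrite /wt; case: fintype.split => i; last by rewrite divr_gt0.
by case: ifP => _ //; rewrite invr_gt0.
Qed.

Let rhoD : rho + rho = N%:R^-1.
Proof. by field; rewrite gt_eqF. Qed.

Let sum_vertex_wt (V : lmodType R) (x : V) :
  \sum_(j < n.+1) (rho / n.+1%:R) *: x = rho *: x.
Proof.
by rewrite sumr_const card_ord -scaler_nat scalerA mulrC divfK.
Qed.

Let sum_vertex_wtr (x : R) : \sum_(j < n.+1) rho / n.+1%:R * x = rho * x.
Proof. exact: (@sum_vertex_wt R^o x). Qed.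

Let sum_zhat_wt (F : 'I_N -> R) :
  \sum_(i < N) N%:R^-1 * F i = rho * F i0 + rho * F i0 +
    \sum_(i < N | (0 < i)%N) N%:R^-1 * F i.
Proof.
rewrite (bigD1 i0)//= -mulrDl rhoD; congr (_ + _).
by apply: eq_bigl => i; rewrite i0E.
Qed.

Lemma sum_wt : \sum_k wt k = 1.
Proof.
have sN : \sum_(i < N) N%:R^-1 * 1 = 1 :> R.
  by rewrite sumr_const card_ord mulr1 -[LHS]mulr_natr mulVf ?gt_eqF.
rewrite -sN (sum_zhat_wt (fun=> 1)) big_pt wt_lshift/=.
under [in RHS]eq_bigr do rewrite mulr1.
under eq_bigr => i i_gt0 do rewrite wt_lshift i_gt0.
under [X in _ + _ + X = _]eq_bigr do rewrite wt_rshift -[rho / _]mulr1.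
by rewrite sum_vertex_wtr; ring.
Qed.

Lemma sum_wt_pt : \sum_k wt k *: pt k = 0.
Proof.
rewrite big_pt pt_lshift zhat0 scaler0 add0r.
under eq_bigr => i i_gt0 do rewrite wt_lshift i_gt0 pt_lshift.
under [X in _ + X]eq_bigr do rewrite wt_rshift pt_rshift.
by rewrite -!scaler_sumr zhat_sum v_centered !scaler0 addr0.
Qed.

Lemma sum_wt_g : \sum_k wt k * g (pt k) = opt.
Proof.
rewrite big_pt /opt sum_zhat_wt pt_lshift zhat0 loss0_0 !mulr0 !add0r addrC.
congr (_ + _).
  under eq_bigr do rewrite wt_rshift pt_rshift loss0_vertex.
  by rewrite sum_vertex_wtr mulrC.
by apply: eq_bigr => i i_gt0; rewrite wt_lshift i_gt0 pt_lshift.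
Qed.

Lemma loss_integral (w : 'I_(N + n.+1) -> R) (mu : probability T R) x :
  (forall k, 0 <= w k) -> \sum_k w k = 1 ->
  (forall A, measurable A -> mu A = weighted_diracs w (pt : _ -> T) A) ->
  (\int[mu]_z (loss zhat v gamma eps x (z : 'rV[R]_n))%:E =
    (dotv x x - 2 * dotv x (\sum_k w k *: pt k) + \sum_k w k * g (pt k))%:E)%E.
Proof.
move=> w0 w1 muE; rewrite (weighted_diracs_integral w0 muE); last first.
  exact: measurable_loss.
congr EFin; under eq_bigr do rewrite loss_shift mulrDr mulrBr.
rewrite big_split sumrB -mulr_suml w1 mul1r norm2_sqr; congr (_ - _ + _).
rewrite dotvC dotv_suml mulr_sumr; apply: eq_bigr => k _.
by rewrite dotvZl (dotvC x); ring.
Qed.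

(** * Measures attaining the bound *)

Section Optimal.
Variable Q : probability T R.
Hypotheses (PQ : ball_ambiguity Q) (optQ : (opt%:E <= dual Q)%E).

Lemma small_slack delta : 0 < delta ->
  exists2 pi : probability (T * T)%type R, coupling Q (empirical zhat) pi &
  (\int[pi]_z (pslack z)%:E <= delta%:E)%E.
Proof.
move=> d0; have [pi piQ le_opt] := pslack_integral_le PQ d0; exists pi => //.
rewrite -(@leeD2lE _ opt%:E)// -EFinD; apply: le_trans le_opt.
by apply: leeD2r; apply: le_trans optQ _; exact: dual_le_loss.
Qed.

Lemma optimal_support : Q (~` range pt) = 0%E.
Proof.
have mS : measurable (~` range pt : set T).
  by apply: measurableC; apply: measurable_closed_rV; exact: closed_range_ord.
(* Least slack over the samples: it vanishes only on [range pt], and its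
   expectation is bounded by that of the slack of any plan. *)
pose m (z : T) : R := \big[Num.min/1]_(i < N) pslack (z, zhat i : T).
have m_ge0 z : 0 <= m z.
  by rewrite le_bigmin// => i _; exact: pslack_ge0.
have mm : measurable_fun setT m.
  by apply: measurable_bigminr => // i; exact: measurable_pslack.
have m0 : (\int[Q]_z (m z)%:E = 0)%E.
  apply/eqP; rewrite eq_le integral_ge0 ?andbT//; last first.
    by move=> z _; rewrite lee_fin.
  apply/lee_addgt0Pr => d d0; rewrite add0e.
  have [pi piQ] := small_slack d0; apply: le_trans.
  rewrite -(coupling_integral_fst piQ)//; apply: ae_ge0_le_integral => //.
  - by move=> z _; rewrite lee_fin.
  - by apply/measurable_EFinP; exact: (measurableT_comp mm measurable_fst).
  - by move=> z _; rewrite lee_fin pslack_ge0.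
  - exact/measurable_EFinP.
  - have aeF := ae_filter_ringOfSetsType pi.
    apply: filterS (coupling_ae PQ.1 piQ) => -[z y] /= [_ [i _ <-]] _.
    by rewrite lee_fin; exact: bigmin_le_cond.
have /(ae_eq_integral_abs Q measurableT) : (\int[Q]_z `|(m z)%:E| = 0)%E.
  by under eq_integral do rewrite gee0_abs ?lee_fin//.
move=> /(_ _)/wrap[]; first exact/measurable_EFinP.
move=> aem.
have aeB : {ae Q, forall z : T, unit_ball2 (z : 'rV[R]_n)}.
  exists (~` (unit_ball2 : set T)); split => //.
    by apply: measurableC; exact: measurable_unit_ball2.
  rewrite probability_setC; last exact: measurable_unit_ball2.
  by rewrite PQ.1 subee.
apply/negligibleP => //.
have aeF := ae_filter_ringOfSetsType Q.
have : {ae Q, forall z : T, range pt (z : 'rV[R]_n)}; last by [].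
apply: filterS2 aem aeB => z /= /(_ Logic.I) [] mz z1.
apply: contrapT => /range_pt[zi zv].
suff : 0 < m z by rewrite mz ltxx.
apply: lt_bigmin => // i _; rewrite lt_max; apply/orP; left.
by apply: slack_gt0.
Qed.

Lemma optimal_sample (i : 'I_N) : (0 < i)%N -> fine (Q [set zhat i]) = N%:R^-1.
Proof.
move=> i_gt0; pose phi : T -> R := \1_[set zhat i].
have mphi : measurable_fun setT phi.
  by apply: measurable_indic; exact: measurable_rV1.
have phiE z : phi z = ((z : 'rV[R]_n) == zhat i)%:R.
  rewrite /phi indicE; have [->|/eqP zi] := eqVneq (z : 'rV[R]_n) (zhat i).
    by rewrite mem_set.
  by rewrite memNset.
have [eta eta0 etaP] := @exists_lower_bound _ _
  [pred p : 'I_(N + n.+1) * 'I_N | 0 < slack (pt p.1) (zhat p.2)]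
  (fun p => slack (pt p.1) (zhat p.2)) (fun _ => id).
have Qphi : (\int[Q]_z (phi z)%:E = (fine (Q [set zhat i]))%:E)%E.
  rewrite integral_indic ?setIT ?fineK ?fin_num_measure//; exact: measurable_rV1.
have phi_ge0 z : 0 <= phi z by rewrite phiE.
have Pphi : \sum_(j < N) N%:R^-1 * phi (zhat j) = N%:R^-1.
  rewrite (bigD1 i)//= phiE eqxx mulr1 big1 ?addr0// => j ji.
  by rewrite phiE (inj_eq zhat_inj) (negPf ji) mulr0.
(* [eta |phi z.1 - phi z.2| <= pslack z] almost surely, so the expectations
   of [phi] under the two marginals agree up to an arbitrarily small error. *)
have aeP pi : coupling Q (empirical zhat) pi ->
    {ae pi, forall z, eta * `|phi z.1 - phi z.2| <= pslack z}.
  move=> piQ.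
  have aeS : {ae pi, forall z, range pt (z.1 : 'rV[R]_n)}.
    exists ((~` range pt) `*` setT); split.
    - apply: measurableX => //; apply: measurableC.
      by apply: measurable_closed_rV; exact: closed_range_ord.
    - apply: etrans (piQ _ _).1 optimal_support; apply: measurableC.
      by apply: measurable_closed_rV; exact: closed_range_ord.
    - by move=> z /= zS; split.
  have aeF := ae_filter_ringOfSetsType pi.
  apply: filterS2 aeS (coupling_ae PQ.1 piQ).
  move=> [_ _] /= [k _ <-] [_ [j _ <-]]; rewrite !phiE.
  have [->|kj] := eqVneq (pt k == zhat i) (zhat j == zhat i).
    by rewrite subrr normr0 mulr0 pslack_ge0.
  apply: (@le_trans _ _ eta).
    rewrite ler_piMr ?(ltW eta0)//.
    by case: eqP; case: eqP => _ _; rewrite ?subrr ?subr0 ?sub0r ?normrN ?normr0 ?normr1.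
  rewrite le_max; apply/orP; left.
  apply: (etaP (k, j)); apply: slack_gt0_mismatch kj => //; exact: pt_le1.
have main (a b : R) (ua ub : T * T -> R) : 
    (forall z, 0 <= ua z) -> (forall z, 0 <= ub z) ->
    measurable_fun setT ua -> measurable_fun setT ub ->
    (forall z, ua z - ub z <= `|phi z.1 - phi z.2|) ->
    (forall pi : probability (T * T)%type R, coupling Q (empirical zhat) pi ->
       (\int[pi]_z (ua z)%:E = a%:E)%E /\ (\int[pi]_z (ub z)%:E = b%:E)%E) ->
    a <= b.
  move=> ua0 ub0 mua mub uab abE; apply/ler_addgt0Pr => d d0.
  have [|pi piQ slack_le] := @small_slack (eta * d); first exact: mulr_gt0.
  have [aE bE] := abE pi piQ; rewrite -(ler_pM2l eta0) mulrDr.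
  rewrite -lee_fin EFinD; apply: le_trans (leeD2l _ slack_le).
  have mea : measurable_fun setT (fun z => (eta * ua z)%:E).
    by apply/measurable_EFinP; exact: measurable_funM.
  have meb : measurable_fun setT (fun z => (eta * ub z)%:E).
    by apply/measurable_EFinP; exact: measurable_funM.
  have scale (c : R) (u : T * T -> R) : (forall z, 0 <= u z) -> measurable_fun setT u ->
      (\int[pi]_z (u z)%:E = c%:E -> (eta * c)%:E = \int[pi]_z (eta * u z)%:E)%E.
    move=> u0 mu uE; under eq_integral do rewrite EFinM.
    rewrite ge0_integralZl ?uE//; first exact/measurable_EFinP.
      by move=> z _; rewrite lee_fin.
    by rewrite lee_fin ltW.
  rewrite (scale a ua)// (scale b ub)// -ge0_integralD//; first last.
  - exact/measurable_EFinP.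
  - by move=> z _; rewrite lee_fin pslack_ge0.
  - by move=> z _; rewrite lee_fin mulr_ge0 ?(ltW eta0).
  apply: ae_ge0_le_integral => //.
  - by move=> z _; rewrite lee_fin mulr_ge0 ?(ltW eta0).
  - move=> z _; rewrite -EFinD lee_fin addr_ge0 ?pslack_ge0//.
    by rewrite mulr_ge0 ?(ltW eta0).
  - by apply: emeasurable_funD => //; exact/measurable_EFinP.
  - have aeF := ae_filter_ringOfSetsType pi.
    apply: filterS (aeP pi piQ) => z h _; rewrite -EFinD lee_fin -lerBlDl.
    by apply: le_trans h; rewrite -mulrBr ler_pM2l.
have mphi1 : measurable_fun setT (fun z : T * T => phi z.1).
  exact: (measurableT_comp mphi measurable_fst).
have mphi2 : measurable_fun setT (fun z : T * T => phi z.2).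
  exact: (measurableT_comp mphi measurable_snd).
have int1 pi : coupling Q (empirical zhat) pi ->
    (\int[pi]_z (phi z.1)%:E = (fine (Q [set zhat i]))%:E)%E.
  by move=> piQ; rewrite (coupling_integral_fst piQ mphi).
have int2 pi : coupling Q (empirical zhat) pi ->
    (\int[pi]_z (phi z.2)%:E = (N%:R^-1)%:E)%E.
  by move=> piQ; rewrite (coupling_integral_snd piQ mphi) ?Pphi.
apply/eqP; rewrite eq_le; apply/andP; split.
  apply: (main _ _ (fun z => phi z.1) (fun z => phi z.2)) => // [z|pi piQ].
    exact: ler_norm.
  by rewrite int1// int2.
apply: (main _ _ (fun z => phi z.2) (fun z => phi z.1)) => // [z|pi piQ].
  by rewrite distrC; exact: ler_norm.
by rewrite int1// int2.
Qed.

Let q k := fine (Q [set pt k]).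

Let q_ge0 k : 0 <= q k. Proof. exact: fine_ge0. Qed.

Let Q_diracs A : measurable A -> Q A = weighted_diracs q (pt : _ -> T) A.
Proof. exact: finite_support_weighted_diracs pt_inj optimal_support. Qed.

Let sum_q : \sum_k q k = 1.
Proof.
have := Q_diracs measurableT; rewrite probability_setT /weighted_diracs.
by under eq_bigr do rewrite diracT mule1; rewrite sumEFin => -[].
Qed.

Let mean : 'rV[R]_n := \sum_k q k *: pt k.

Let opt_le x : unit_ball2 x ->
  opt <= dotv x x - 2 * dotv x mean + \sum_k q k * g (pt k).
Proof.
move=> x1; rewrite -lee_fin -(loss_integral x q_ge0 sum_q Q_diracs).
exact: le_trans optQ (dual_le_loss _ x1).
Qed.

Let sum_q_g : \sum_k q k * g (pt k) = opt.
Proof.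
apply/eqP; rewrite eq_le; apply/andP; split; last first.
  by have := opt_le unit_ball2_0; rewrite !dotv0l mulr0 subr0 add0r.
have := loss_integral 0 q_ge0 sum_q Q_diracs.
rewrite !dotv0l mulr0 subr0 add0r => intg.
by rewrite -lee_fin -intg; exact: loss0_integral_le_opt.
Qed.

(* At [x = t mean] with [t = 1 / (1 + |mean|^2)], [x] is in the ball and
   optimality reads [0 <= t (1 - t) - 2 (1 - t)], forcing [t = 1]. *)
Let mean_eq0 : mean = 0.
Proof.
apply: dotvv_eq0; have := dotvv_ge0 mean.
set a := dotv mean mean => a0; pose t := (1 + a)^-1.
have t0 : 0 < t by rewrite invr_gt0; lra.
have ta : t * a = 1 - t by rewrite /t; field; rewrite gt_eqF//; lra.
have t1 : t <= 1 by rewrite -subr_ge0 -ta mulr_ge0// ltW.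
have tm : dotv (t *: mean) (t *: mean) = t * (1 - t).
  by rewrite dotvZl dotvC dotvZl -ta.
have tm1 : unit_ball2 (t *: mean).
  rewrite /unit_ball2/= -(@ler_pXn2r _ 2)// ?nnegrE ?norm2_ge0//.
  by rewrite norm2_sqr tm; nra.
have := opt_le tm1; rewrite sum_q_g tm dotvZl -/a ta => le_opt.
have : 1 - t <= 0 by nra.
by rewrite -ta pmulr_rle0.
Qed.

Lemma optimal_weights k : fine (Q [set pt k]) = wt k.
Proof.
have e0 := eps_gt0; have e1 := eps_lt_subgamma; have c0 := gamma_gt0.
rewrite -/(q k).
have qz (i : 'I_N) : (0 < i)%N -> q (lshift _ i) = N%:R^-1.
  by move=> i_gt0; rewrite /q pt_lshift optimal_sample.
have qv0 : \sum_(j < n.+1) q (rshift N j) *: v j = 0.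
  have := mean_eq0; rewrite /mean big_pt pt_lshift zhat0 scaler0 add0r.
  under eq_bigr => i i_gt0 do rewrite qz// pt_lshift.
  rewrite -scaler_sumr zhat_sum scaler0 add0r => h.
  by rewrite -[RHS]h; apply: eq_bigr => j _; rewrite pt_rshift.
have qvs : \sum_(j < n.+1) q (rshift N j) = rho.
  have := sum_q_g; rewrite -sum_wt_g !big_pt !pt_lshift zhat0 loss0_0 !mulr0 !add0r.
  under eq_bigr => i i_gt0 do rewrite qz//.
  under [in RHS]eq_bigr => i i_gt0 do rewrite wt_lshift i_gt0.
  move/addrI; under eq_bigr do rewrite pt_rshift loss0_vertex.
  under [in RHS]eq_bigr do rewrite pt_rshift wt_rshift loss0_vertex.
  rewrite sum_vertex_wtr -mulr_suml; apply: mulIf.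
  by rewrite gt_eqF//; lra.
have qv j : q (rshift N j) = rho / n.+1%:R.
  have := v_simplex.1 (fun j => q (rshift N j) - rho / n.+1%:R).
  rewrite sumrB qvs; under [X in _ - X]eq_bigr do rewrite -[rho / _]mulr1.
  rewrite sum_vertex_wtr mulr1 subrr => /(_ erefl).
  under eq_bigr do rewrite scalerBl.
  rewrite sumrB qv0 -scaler_sumr v_centered scaler0 subrr => /(_ erefl j).
  exact: subr0_eq.
rewrite -(splitK k); case: (fintype.split k) => [i|j] /=; last first.
  by rewrite qv wt_rshift.
have [i_eq0|i_gt0] := posnP i; last by rewrite qz// wt_lshift i_gt0.
have -> : i = i0 by exact: val_inj.
have := sum_q; rewrite -sum_wt !big_pt qvs.
under eq_bigr => j j_gt0 do rewrite qz//.
under [in RHS]eq_bigr => j j_gt0 do rewrite wt_lshift j_gt0.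
under [X in _ = _ + X]eq_bigr do rewrite wt_rshift -[rho / _]mulr1.
by rewrite sum_vertex_wtr mulr1 => /addIr/addIr.
Qed.

Lemma optimal_diracs A :
  measurable A -> Q A = weighted_diracs wt (pt : _ -> T) A.
Proof.
move=> mA; rewrite Q_diracs//; apply: eq_bigr => k _.
by rewrite /q optimal_weights.
Qed.
End Optimal.

(* The sample from which an optimal plan moves mass to [pt k]. *)
Let anchor (k : 'I_(N + n.+1)) : 'I_N :=
  match fintype.split k with inl i => i | inr _ => i0 end.

Let anchor_lshift i : anchor (lshift _ i) = i.
Proof. by rewrite /anchor (unsplitK (inl i)). Qed.

Let anchor_rshift j : anchor (rshift N j) = i0.
Proof. by rewrite /anchor (unsplitK (inr j)). Qed.

Lemma weighted_diracs_anchor (A : set T) :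
  weighted_diracs wt (zhat \o anchor : _ -> T) A = empirical zhat A.
Proof.
rewrite empirical_weighted_diracs /weighted_diracs.
under eq_bigr do rewrite diracE -EFinM.
under [in RHS]eq_bigr do rewrite diracE -EFinM.
rewrite !sumEFin sum_zhat_wt big_pt/= anchor_lshift wt_lshift/=.
under eq_bigr => i i_gt0 do rewrite wt_lshift i_gt0 anchor_lshift.
under [X in (_ + X)%:E]eq_bigr do rewrite anchor_rshift wt_rshift.
by rewrite sum_vertex_wtr addrAC.
Qed.

Lemma Qdual_weighted_diracs (A : set T) :
  Qdual zhat v A = weighted_diracs wt (pt : _ -> T) A.
Proof.
rewrite /Qdual /weighted_diracs.
under eq_bigr do rewrite diracE.
under [X in (_ + _ * X)%E]eq_bigr do rewrite diracE.
under [in RHS]eq_bigr do rewrite diracE -EFinM.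
rewrite diracE !sumEFin -!EFinM -!EFinD -?EFinM -?EFinD; congr EFin.
rewrite big_pt pt_lshift wt_lshift/= zhat0.
under [X in _ = _ + X + _]eq_bigr => i i_gt0 do rewrite wt_lshift i_gt0 pt_lshift.
under [X in _ = _ + X]eq_bigr do rewrite pt_rshift wt_rshift.
rewrite -!mulr_sumr; field.
by rewrite nat1r pnatr_eq0 /= gt_eqF.
Qed.

Lemma optimal_exists : exists Qs : probability T R,
  [/\ forall A, Qs A = weighted_diracs wt (pt : _ -> T) A,
      ball_ambiguity Qs & (opt%:E <= dual Qs)%E].
Proof.
have wt_ge0 k := ltW (wt_gt0 k).
have [Qs QsE] := weighted_diracs_probability (pt : _ -> T) wt_ge0 sum_wt.
exists Qs; split => //; last first.
  apply: le_ereal_inf_tmp => _ [x _ <-]; rewrite unlock.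
  rewrite (loss_integral _ wt_ge0 sum_wt) => [|A _]; last exact: QsE.
  rewrite sum_wt_pt sum_wt_g (dotvC x 0) dotv0l mulr0 subr0 lee_fin.
  by rewrite lerDr dotvv_ge0.
split.
  rewrite QsE /weighted_diracs; under eq_bigr => k _.
    rewrite diracE mem_set; last exact: pt_le1.
    by rewrite mule1; over.
  by rewrite sumEFin sum_wt.
pose pp k : T * T := (pt k : T, zhat (anchor k) : T).
have [pi piE] := weighted_diracs_probability pp wt_ge0 sum_wt.
apply: ge_ereal_inf; exists
    ('E_pi[fun z : T * T => norm2 ((z.1 : 'rV[R]_n) - (z.2 : 'rV[R]_n))])%E.
  exists pi => // A mA; rewrite !piE QsE -weighted_diracs_anchor; split.
    apply: eq_bigr => k _; rewrite !diracE; congr (_ * (nat_of_bool _)%:R%:E)%E.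
    by apply/idP/idP => /set_mem h; apply/mem_set; [case: h|split].
  apply: eq_bigr => k _; rewrite !diracE; congr (_ * (nat_of_bool _)%:R%:E)%E.
  by apply/idP/idP => /set_mem h; apply/mem_set; [case: h|split].
rewrite unlock (weighted_diracs_integral wt_ge0 (fun A _ => piE A)); last first.
  by apply: measurable_dist2; [exact: measurable_fst|exact: measurable_snd].
rewrite lee_fin big_pt /pp/= pt_lshift anchor_lshift subrr norm2_0 mulr0 add0r.
rewrite big1 => [|i _]; last first.
  by rewrite pt_lshift anchor_lshift subrr norm2_0 mulr0.
under eq_bigr do rewrite pt_rshift anchor_rshift zhat0 subr0 v_norm wt_rshift.
by rewrite sum_vertex_wtr mulr1 add0r.
Qed.

Lemma least_favorable_diracs Q :
  least_favorable unit_ball2 (loss zhat v gamma eps) ball_ambiguity Q ->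
  forall A, measurable A -> Q A = weighted_diracs wt (pt : _ -> T) A.
Proof.
move=> [PQ maxQ]; apply: optimal_diracs => //.
by have [Qs [_ PQs /le_trans]] := optimal_exists; apply; exact: maxQ.
Qed.

Lemma card_range_pt : range pt #= `I_(N + n + 1).
Proof.
rewrite -addnA addn1; apply: card_eq_trans (inj_card_eq _) _.
  by move=> k l _ _; exact: pt_inj.
rewrite (_ : `I_(N + n.+1) = range (@nat_of_ord (N + n.+1))).
  rewrite card_eq_sym; apply: inj_card_eq => k l _ _; exact: val_inj.
by apply/seteqP; split=> [k kN|_ [k _ <-]] /=; [exists (Ordinal kN)|].
Qed.

Section Support.
Variable Q : probability T R.
Hypothesis QE : forall A, measurable A -> Q A = weighted_diracs wt (pt : _ -> T) A.

Lemma range_pt_atoms : range pt `<=` atoms Q.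
Proof.
move=> _ [k _ <-]; rewrite /atoms/= QE; last exact: measurable_rV1.
rewrite /weighted_diracs (bigD1 k)//= diracE mem_set// mule1.
rewrite -[ltLHS]adde0 lte_leD// ?lte_fin ?wt_gt0//.
by apply: sume_ge0 => l _; rewrite mule_ge0// lee_fin ltW// wt_gt0.
Qed.

Lemma msupport_range_pt : msupport Q = range pt.
Proof.
apply/seteqP; split=> [z zQ|z ptz U oU Uz]; last first.
  apply: lt_le_trans (range_pt_atoms ptz) _; apply: le_measure.
  - by rewrite inE; exact: measurable_rV1.
  - by rewrite inE; exact: measurable_open_rV.
  - by move=> _ ->.
apply: contrapT => ptz; have oC := closed_openC (@closed_range_ord _ _ _ pt).
have := zQ _ oC ptz; rewrite QE; last exact: measurable_open_rV.
rewrite /weighted_diracs big1 ?ltxx// => k _.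
by rewrite diracE memNset ?mule0//=; apply; exists k.
Qed.
End Support.

Local Notation LF :=
  (least_favorable unit_ball2 (loss zhat v gamma eps) ball_ambiguity).

Lemma least_favorable_support Q : LF Q ->
  `I_(N + n + 1) #<= msupport Q `&` atoms Q.
Proof.
move=> /least_favorable_diracs QE; rewrite -(card_le_eql card_range_pt).
apply: subset_card_le => z ptz; split; last exact: range_pt_atoms.
by rewrite msupport_range_pt.
Qed.

Lemma least_favorable_unique : exists Qs : probability T R,
  [/\ forall A, measurable A -> Qs A = Qdual zhat v A,
      LF Qs,
      msupport Qs #= `I_(N + n + 1) &
      forall Q : probability T R, LF Q -> forall A, measurable A -> Q A = Qs A].
Proof.
have [Qs [QsE PQs optQs]] := optimal_exists; exists Qs; split.
- by move=> A _; rewrite QsE Qdual_weighted_diracs.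
- by split=> // Q PQ; apply: le_trans optQs; exact: dual_le_opt.
- by rewrite msupport_range_pt// card_range_pt.
- by move=> Q /least_favorable_diracs QE A mA; rewrite QE.
Qed.

End Setting.

Theorem lemma14 (R : realType) (n N : nat)
    (zhat : 'I_N -> 'rV[R]_n) (v : 'I_n.+1 -> 'rV[R]_n) (M gamma eps : R)
    (N_ge3 : (3 <= N)%N)
    (zhat_first : forall i : 'I_N, i = 0%N :> nat -> zhat i = 0)
    (zhat_distinct : forall i j : 'I_N, (0 < i)%N -> (0 < j)%N ->
       zhat i = zhat j -> i = j)
    (zhat_norm : forall i : 'I_N, (0 < i)%N -> norm2 (zhat i) = 1)
    (zhat_sum : \sum_(i < N | (0 < i)%N) zhat i = 0)
    (v_simplex : regular_simplex v)
    (v_centered : \sum_(k < n.+1) v k = 0)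
    (v_norm : forall k : 'I_n.+1, norm2 (v k) = 1)
    (M_max : is_maximum
       [set dotv (zhat i) (v k) | i in [set i : 'I_N | (0 < i)%N]
                                & k in [set: 'I_n.+1]] M)
    (M_lt1 : M < 1)
    (gamma_gtM : M < gamma) (gamma_lt1 : gamma < 1)
    (eps_gt0 : 0 < eps) (eps_lt : eps < Num.min (1 - gamma) (gamma - M)) :
  let c := fun z zh : 'rV[R]_n => norm2 (z - zh) in
  let rho : R := (2 * N%:R)^-1 in
  let P := ambiguity_set unit_ball2 c (empirical zhat) rho in
  let LF := least_favorable unit_ball2 (loss zhat v gamma eps) P in
  (forall Q : probability (borelRV R n) R, LF Q ->
     `I_(N + n + 1) #<= msupport Q `&` atoms Q) /\
  (exists Qstar : probability (borelRV R n) R,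
     [/\ forall A, measurable A -> Qstar A = Qdual zhat v A,
         LF Qstar,
         msupport Qstar #= `I_(N + n + 1) &
         forall Q : probability (borelRV R n) R, LF Q ->
           msupport Q #= `I_(N + n + 1) ->
           forall A, measurable A -> Q A = Qstar A]).
Proof.
split=> [Q LFQ|].
  exact: (least_favorable_support N_ge3 zhat_first zhat_distinct zhat_norm
    zhat_sum v_simplex v_centered v_norm M_max M_lt1 gamma_gtM eps_gt0 eps_lt LFQ).
have [Qs [QsE LFQs cardQs uniqQs]] := least_favorable_unique N_ge3 zhat_first
  zhat_distinct zhat_norm zhat_sum v_simplex v_centered v_norm M_max M_lt1
  gamma_gtM eps_gt0 eps_lt.
by exists Qs; split => // Q LFQ _; exact: uniqQs.
Qed.
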